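(* Let $a_0,a_1,c_0,c_1$ be non-negative integers, $a=a_0+a_1$, $c=c_0+c_1$. Let $\alpha,\beta\in\binom{[a]}{a_1}$, $\gamma,\delta\in\binom{[c]}{c_1}$ and $\nu\in\binom{[a+c]}{a_1+c_1}$. Then $$\mathrm{Tri}(\alpha\gamma,\nu,\delta\beta)=\mathrm{Tri}(\beta\gamma,\nu,\delta\alpha)=\mathrm{Tri}(\alpha\delta,\nu,\gamma\beta)=\mathrm{Tri}(\beta\delta,\nu,\gamma\alpha),$$ where $\mathrm{Tri}(\lambda,\mu,\nu)$ is the number of triangular puzzles with boundary labels $\lambda,\mu,\nu$.
   Context: Strings: $\binom{[n]}{k}$ denotes the set of binary strings (words in the symbols $0,1$) of length $n$ with exactly $k$ ones; juxtaposition of strings is concatenation. Puzzles: work in the triangular lattice in the plane, whose unit edges make angles $0^\circ,60^\circ,120^\circ$ with the $x$-axis. Edge labels are the three symbols $0$, $1$, $10$ (where $10$ is a single symbol). A unit triangle (upward- or downward-pointing) with labeled edges is an allowed piece if its three labels read clockwise are $(0,0,0)$, $(1,1,1)$, or a cyclic rotation of $(1,0,10)$. Given a convex lattice polygon (sides along lattice directions, some sides possibly of length $0$) each of whose sides is labeled by a binary string, one symbol per unit edge, read clockwise around the polygon, a puzzle with this boundary is an assignment of labels to all unit lattice edges in the polygon which agrees with the prescribed labels on the boundary and for which every unit triangle in the polygon is an allowed piece. $\mathrm{Tri}(\lambda,\mu,\nu)$ is the number of puzzles on the upward-pointing equilateral triangle whose NW, NE and South sides, each read clockwise (so the South side is read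 right to left), are labeled $\lambda,\mu,\nu$. *)

(* Defs.v *)
From HB Require Import structures.
From mathcomp Require Import all_boot.

Set Implicit Arguments.
Unset Strict Implicit.
Unset Printing Implicit Defensive.

Inductive label := L0 | L1 | L10.

Definition option_of_label (l : label) : option bool :=
  match l with L0 => Some false | L1 => Some true | L10 => None end.

Definition label_of_option (o : option bool) : label :=
  match o with Some false => L0 | Some true => L1 | None => L10 end.

Lemma option_of_labelK : cancel option_of_label label_of_option.
Proof. by case. Qed.

HB.instance Definition _ := Finite.copy label (can_type option_of_labelK).

Definition bit_label (b : bool) : label := if b then L1 else L0.

Definition binstrings (n k : nat) : pred (seq bool) :=
  [pred s | (size s == n) && (count_mem true s == k)].

(* [x], [y], [z] are the labels of a unit triangle, of either orientation,
   read clockwise. *)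
Definition allowed (x y z : label) : bool :=
  (x, y, z) \in
    [:: (L0, L0, L0); (L1, L1, L1);
        (L1, L0, L10); (L0, L10, L1); (L10, L1, L0)].

(* Coordinates (i, j) denote the lattice point i * e1 + j * e2, where e1 and e2
   are the unit vectors at angles 0 and 60 degrees. The triangle of side n has
   corners (0, 0), (n, 0) and (0, n), and (i, j) with i + j < n is the bottom
   left vertex of one of its upward unit triangles. *)
Definition upcell (n : nat) := {p : 'I_n * 'I_n | p.1 + p.2 < n}.

Definition cx n (p : upcell n) : nat := (val p).1.
Definition cy n (p : upcell n) : nat := (val p).2.

Inductive side := NW | NE | South.

Definition option_of_side (s : side) : option bool :=
  match s with NW => Some false | NE => Some true | South => None end.

Definition side_of_option (o : option bool) : side :=
  match o with Some false => NW | Some true => NE | None => South end.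

Lemma option_of_sideK : cancel option_of_side side_of_option.
Proof. by case. Qed.

HB.instance Definition _ := Finite.copy side (can_type option_of_sideK).

(* Every unit edge of the triangle is a side of exactly one upward unit
   triangle. *)
Definition edge (n : nat) : finType := (side * upcell n)%type.

Definition labeling (n : nat) : finType := {ffun edge n -> label}.

Definition up_pieces n (f : labeling n) : bool :=
  [forall p : upcell n, allowed (f (NW, p)) (f (NE, p)) (f (South, p))].

(* The downward unit triangle with vertices (i + 1, j), (i + 1, j + 1) and
   (i, j + 1) has as its top, right and left edges the South edge of the upward
   triangle at (i, j + 1), the NW edge of the one at (i + 1, j) and the NE edge
   of the one at (i, j). *)
Definition down_pieces n (f : labeling n) : bool :=
  [forall p : upcell n, forall q : upcell n, forall r : upcell n,
    [&& cx q == (cx p).+1, cy q == cy p, cx r == cx p & cy r == (cy p).+1] ==>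
    allowed (f (South, r)) (f (NW, q)) (f (NE, p))].

(* Each side is read clockwise: NW upwards, NE downwards, South from right to
   left. *)
Definition has_boundary n (lam mu nu : seq bool) (f : labeling n) : bool :=
  [&& size lam == n, size mu == n, size nu == n &
   [forall p : upcell n,
    [&& (cx p == 0) ==>
          (f (NW, p) == bit_label (nth false lam (cy p))),
        (cx p + cy p == n.-1) ==>
          (f (NE, p) == bit_label (nth false mu (cx p))) &
        (cy p == 0) ==>
          (f (South, p) == bit_label (nth false nu (n.-1 - cx p)))]]].

Definition puzzles n (lam mu nu : seq bool) : {set labeling n} :=
  [set f | [&& has_boundary lam mu nu f, up_pieces f & down_pieces f]].

(* [n] is the side length; the number is 0 unless all three strings have
   length [n]. *)
Definition Tri (n : nat) (lam mu nu : seq bool) : nat :=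
  #|puzzles n lam mu nu|.

(* Main.v *)
(* Cut off the corner triangle with sides [alpha], [beta]: the count becomes a
   sum over the words [sigma] on the cut, and a charge (Green's theorem) shows
   that [sigma] has no [10].  So it is enough to swap [gamma] and [delta] in the
   remaining trapezoid; the swap of [alpha] and [beta] is the case of a
   trapezoid with an empty short side.

   For the trapezoid we use a Yang-Baxter argument.  A line with three states
   and a spectral parameter [b] runs along lattice edges and changes the labels
   that it crosses; its weights are chosen so that it can be moved across a unit
   triangle of either orientation.  It is transparent for the two parallel
   sides, so moving it from the sides [nu], [delta] to the sides [gamma],
   [sigma] shows that the puzzle count S(gamma, delta) satisfies
   S(K gamma, delta) = S(gamma, K delta), where K = sum_k b^k K_k and K_k adds
   a vertical strip to the partition of a binary string ([k] is the number of
   ones that do not move).  The K_k commute, by the Yang-Baxter equation for two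
   lines, and applying them to the sorted string produces all strings with the
   same content, by triangularity.  Hence S is symmetric. *)

Require Import Defs.
From mathcomp Require Import all_boot.
From mathcomp Require Import all_algebra ring zify.

Set Implicit Arguments.
Unset Strict Implicit.
Unset Printing Implicit Defensive.

Import GRing.Theory.

(** * Puzzles as transfer matrices *)

Lemma big_label (R : Type) (idx : R) (op : Monoid.com_law idx) (F : label -> R) :
  \big[op/idx]_(l : label) F l = op (F L0) (op (F L1) (F L10)).
Proof.
rewrite (bigD1 L0) //= (bigD1 L1) //= (bigD1 L10) //= big1 ?Monoid.mulm1 //.
by case.
Qed.

(** Sequences instead of tuples, so that sums over words unfold letter by letter along the
    recursions [strip], [tri] and [line] below. *)
Fixpoint words n : seq (seq label) :=
  if n is m.+1 then [seq l :: v | l <- enum {: label}, v <- words m] else [:: [::]].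

Lemma big_words_cons (R : Type) (idx : R) (op : Monoid.com_law idx) n F :
  \big[op/idx]_(v <- words n.+1) F v
  = \big[op/idx]_(l : label) \big[op/idx]_(v <- words n) F (l :: v).
Proof. by rewrite big_allpairs_dep big_enum. Qed.

Lemma mem_words n v : (v \in words n) = (size v == n).
Proof.
elim: n v => [|n IHn] [|l v] //=.
  by apply/allpairsP => -[[x y] []].
apply/allpairsP/idP => [[[x y] /= [_ yn [_ ->]]]|szv].
  by rewrite eqSS -IHn.
by exists (l, v); rewrite /= mem_enum IHn.
Qed.

Lemma words_uniq n : uniq (words n).
Proof.
by elim: n => //= n IHn; apply: allpairs_uniq => //;
  rewrite ?enum_uniq // => -[? ?] [? ?] _ _ [-> ->].
Qed.

(* The strip between two consecutive lines parallel to the NE side, read from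
   its top to its bottom: [p] is the first NW label, [d] the last South label,
   [nu] and [tau] are the labels on the outer and on the inner line. *)
Fixpoint strip (p : label) (nu tau : seq label) (d : label) : nat :=
  match nu, tau with
  | [:: n], [::] => allowed p n d
  | n :: nu', s :: tau' =>
      \sum_r \sum_p' allowed p n r * allowed p' s r * strip p' nu' tau' d
  | _, _ => 0
  end.

(* The NW side [lam] is read downwards here, so that the outermost strip uses
   the head of both [lam] and [mu]. *)
Fixpoint tri (lam nu mu : seq label) : nat :=
  match lam, mu with
  | [::], [::] => nu == [::]
  | g :: lam', d :: mu' =>
      \sum_(tau <- words (size lam')) tri lam' tau mu' * strip g nu tau d
  | _, _ => 0
  end.

Lemma allowed_rot x y z : allowed y z x = allowed x y z.
Proof. by case: x; case: y; case: z. Qed.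

Lemma sum_tuple_words n (F : seq label -> nat) :
  \sum_(t : n.-tuple label) F t = \sum_(v <- words n) F v.
Proof.
rewrite -big_enum -(big_map val predT); apply: perm_big; apply: uniq_perm.
- by rewrite (map_inj_uniq val_inj) enum_uniq.
- exact: words_uniq.
move=> v; rewrite mem_words; apply/mapP/idP => [[t _ ->]|/eqP szv].
  by rewrite size_tuple.
by exists (tcast szv (in_tuple v)); rewrite ?mem_enum //= val_tcast.
Qed.

Lemma sum_nat_delta (T : eqType) (r : seq T) (t : T) (F : T -> nat) :
  uniq r -> t \in r -> \sum_(x <- r) (x == t) * F x = F t.
Proof.
move=> ur tr; rewrite (bigD1_seq t) //= eqxx mul1n big1 ?addn0 //.
by move=> x /negPf->.
Qed.

Lemma all_iotaS a m : all a (iota 0 m.+1) = a 0 && all (fun i => a i.+1) (iota 0 m).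
Proof. by rewrite /= (iotaDl 1 0) all_map. Qed.

(** All inner edges of a strip at once: [N] and [S] list the NW and South labels of its upward
    triangles from top to bottom. [strip] is the transfer-matrix form of the sum over [N] and
    [S]. *)
Definition strip_ok p (nu tau : seq label) d (N S : seq label) : bool :=
  [&& nth L0 N 0 == p, nth L0 S (size tau) == d,
      all (fun i => allowed (nth L0 N i) (nth L0 nu i) (nth L0 S i))
        (iota 0 (size tau).+1)
    & all (fun i => allowed (nth L0 S i) (nth L0 N i.+1) (nth L0 tau i))
        (iota 0 (size tau))].

Lemma strip_ok_cons p n nu s tau d q N r S :
  strip_ok p (n :: nu) (s :: tau) d (q :: N) (r :: S)
  = [&& q == p, allowed p n r, allowed (nth L0 N 0) s r
      & strip_ok (nth L0 N 0) nu tau d N S].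
Proof.
rewrite /strip_ok [size (_ :: _)]/= [X in _ && (_ && (_ && X))]all_iotaS
  [X in _ && (_ && (X && _))]all_iotaS [nth L0 (q :: N) 0]/=.
have [->|] //= := eqVneq q p; rewrite eqxx -(allowed_rot r _ s) /=.
by rewrite [in LHS]andbCA -!andbA; do !bool_congr.
Qed.

Lemma strip_sum p nu tau d : size nu = (size tau).+1 ->
  strip p nu tau d
  = \sum_(N <- words (size tau).+1) \sum_(S <- words (size tau).+1) strip_ok p nu tau
    d N S.
Proof.
elim: tau p nu => [|s tau IH] p [|n nu] // [] sz.
  case: nu sz => // _; rewrite big_words_cons.
  under eq_bigr do rewrite big_seq1 big_words_cons.
  rewrite (bigD1 p) //= (bigD1 d) //= big_seq1 big1 => [|d' /negPf dd].
    rewrite addn0 big1 => [|q /negPf qp]; last first.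
      by apply: big1 => r _; rewrite big_seq1 /strip_ok /= qp.
    by rewrite addn0 /strip_ok /= !eqxx !andbT.
  by rewrite big_seq1 /strip_ok /= dd andbF.
have -> : strip p (n :: nu) (s :: tau) d =
   (\sum_r \sum_p' allowed p n r * allowed p' s r * strip p' nu tau d)%N.
  by case: (nu) sz.
rewrite [size (s :: tau)]/= big_words_cons.
set W2 := words _.+2; set W1 := words _.
rewrite [RHS](bigD1 p) //= [X in (_ + X)%N]big1 => [|q /negPf qp]; last first.
  apply: big1 => N _; rewrite /W2 big_words_cons big1 // => r _.
  by apply: big1 => S _; rewrite strip_ok_cons qp.
rewrite addn0; symmetry.
under eq_bigr do rewrite /W2 big_words_cons.
rewrite exchange_big; apply: eq_bigr => r _.
under [RHS]eq_bigr do rewrite IH // big_distrr.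
rewrite [RHS]exchange_big; apply: eq_bigr => N _.
(* The next NW label [p'] must be the head of [N], which collapses the sum over [p']. *)
rewrite [RHS](bigD1 (nth L0 N 0)) //= [X in (_ + X)%N]big1 ?addn0 => [|p' /negPf pN];
  last first.
  by rewrite big1 ?muln0 // => S _; rewrite /strip_ok eq_sym pN.
rewrite big_distrr; apply: eq_bigr => S _.
by rewrite strip_ok_cons eqxx /= !mulnb andbA.
Qed.

Definition bits : seq bool -> seq label := map bit_label.

Definition mk_cell n i j (lt_ij : i + j < n) : upcell n :=
  exist _ (Ordinal (leq_ltn_trans (leq_addr j i) lt_ij),
           Ordinal (leq_ltn_trans (leq_addl i j) lt_ij)) lt_ij.

(** Access by plain coordinates, with default [L0] outside the triangle, keeps membership proofs out
    of the gluing argument. *)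
Definition look n (f : labeling n) s i j : label :=
  if @idP (i + j < n) is ReflectT lt_ij then f (s, mk_cell lt_ij) else L0.

Lemma cell_lt n (p : upcell n) : cx p + cy p < n.
Proof. exact: valP p. Qed.

Lemma look_cell n (f : labeling n) s p : look f s (cx p) (cy p) = f (s, p).
Proof.
rewrite /look; case: {-}_ / idP => [lt_ij|]; last by rewrite cell_lt.
by congr (f (s, _)); apply: val_inj; case: p lt_ij => -[i j] ? ? /=; congr (_, _);
  apply: val_inj.
Qed.

Lemma look_mk n (f : labeling n) s i j (lt_ij : i + j < n) :
  look f s i j = f (s, mk_cell lt_ij).
Proof. by rewrite -look_cell. Qed.

Lemma labelingP n (f g : labeling n) :
  (forall s i j, i + j < n -> look f s i j = look g s i j) -> f = g.
Proof.
by move=> fg; apply/ffunP => -[s p]; rewrite -!look_cell fg ?cell_lt.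
Qed.

(* Like [has_boundary], but with sides that may carry the label [10]. *)
Definition side_labels n (lam mu nu : seq label) (f : labeling n) : bool :=
  [forall p : upcell n,
    [&& (cx p == 0) ==> (f (NW, p) == nth L0 lam (cy p)),
        (cx p + cy p == n.-1) ==> (f (NE, p) == nth L0 mu (cx p)) &
        (cy p == 0) ==> (f (South, p) == nth L0 nu (n.-1 - cx p))]].

Definition puzzle n lam mu nu (f : labeling n) : bool :=
  [&& side_labels lam mu nu f, up_pieces f & down_pieces f].

Definition puzzle_spec n (lam mu nu : seq label) (f : labeling n) : Prop :=
  [/\ forall j, j < n -> look f NW 0 j = nth L0 lam j,
      forall i, i < n -> look f NE i (n.-1 - i) = nth L0 mu i,
      forall i, i < n -> look f South i 0 = nth L0 nu (n.-1 - i),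
      forall i j, i + j < n -> allowed (look f NW i j) (look f NE i j) (look f South
        i j)
    & forall i j, (i + j).+1 < n ->
        allowed (look f South i j.+1) (look f NW i.+1 j) (look f NE i j)].

Lemma puzzleP n lam mu nu (f : labeling n) :
  reflect (puzzle_spec lam mu nu f) (puzzle lam mu nu f).
Proof.
apply: (iffP and3P) => [[/forallP bd /forallP up /forallP down]|[nw ne so up down]].
  split.
  - move=> j ltj; have lt0j : 0 + j < n by [].
    by have /and3P[/implyP/(_ (eqxx _))/eqP] := bd (mk_cell lt0j); rewrite look_mk.
  - move=> i lti; have ltij : i + (n.-1 - i) < n by lia.
    have /and3P[_ /implyP] := bd (mk_cell ltij).
    by rewrite look_mk /cx /cy /= => /(_ _)/eqP-> //; apply/eqP; lia.
  - move=> i lti; have lti0 : i + 0 < n by lia.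
    by have /and3P[_ _ /implyP/(_ (eqxx _))/eqP] := bd (mk_cell lti0); rewrite look_mk.
  - by move=> i j ltij; rewrite !look_mk; apply: up.
  - move=> i j ltij.
    have ltp : i + j < n by lia.
    have ltq : i.+1 + j < n by lia.
    have ltr : i + j.+1 < n by lia.
    move: (down (mk_cell ltp)) => /forallP/(_ (mk_cell ltq))/forallP/(_ (mk_cell
      ltr))/implyP.
    by rewrite !look_mk /cx /cy /= !eqxx; apply.
split.
- apply/forallP => p; have ltp := cell_lt p.
  apply/and3P; split; apply/implyP => /eqP e; rewrite -look_cell; apply/eqP.
  + by rewrite e nw //; lia.
  + by rewrite -ne; [congr look; lia | lia].
  + by rewrite e so //; lia.
- by apply/forallP => p; rewrite -!look_cell; apply: up; apply: cell_lt.
apply/forallP => p; apply/forallP => q; apply/forallP => r; apply/implyP.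
case/and4P => /eqP qx /eqP qy /eqP rx /eqP ry.
rewrite -!look_cell qx qy rx ry; apply: down.
by have := cell_lt q; rewrite qx qy.
Qed.

Lemma nth_bits s i : nth L0 (bits s) i = bit_label (nth false s i).
Proof. by elim: s i => [|e s IH] [|i] //=. Qed.

Lemma Tri_puzzle n lam mu nu : size lam = n -> size mu = n -> size nu = n ->
  Tri n lam mu nu
  = \sum_(f : labeling n) puzzle (bits lam) (bits mu) (bits nu) f.
Proof.
move=> sl sm sn; rewrite /Tri -sum1dep_card big_mkcond; apply: eq_bigr => f _.
rewrite /has_boundary /puzzle /side_labels sl sm sn !eqxx /=.
under [in RHS]eq_forallb do rewrite !nth_bits.
by case: [&& _, _ & _].
Qed.

(** * Building a triangle by adding one strip along its NE side *)

Definition glue n (g : labeling n) (words_of : side -> seq label) : labeling n.+1 :=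
  [ffun e => if cx e.2 + cy e.2 < n then look g e.1 (cx e.2) (cy e.2)
             else nth L0 (words_of e.1) (cx e.2)].

Lemma look_glue n (g : labeling n) W s i j : i + j <= n ->
  look (glue g W) s i j = if i + j < n then look g s i j else nth L0 (W s) i.
Proof.
move=> le_ij.
have lt_ij : i + j < n.+1 by [].
by rewrite (look_mk _ _ lt_ij) ffunE.
Qed.

(** The new upward cells are those with [i + j = n], listed by column. A downward piece of the strip
    meets the old triangle only in an NE edge of it, so the old labeling enters the strip conditions
    only through its NE side [tau]. *)
Lemma puzzle_glue n lam g nu d mu (f : labeling n) N E S :
    size lam = n -> size nu = n.+1 -> size E = n.+1 ->
  puzzle (rcons lam g) nu (d :: mu) (glue f (fun s => match s with NW => N | NE => E
    | South => S end))
  = (E == nu) &&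
    (let tau := mkseq (fun i => look f NE i (n.-1 - i)) n in
     puzzle lam tau mu f && strip_ok g nu tau d N S).
Proof.
move=> szlam sznu szE; set W := fun s : side => _.
have lkW s i j : i + j = n -> look (glue f W) s i j = nth L0 (W s) i.
  by move=> ij; rewrite look_glue ?ij ?ltnn.
have lkf s i j : i + j < n -> look (glue f W) s i j = look f s i j.
  by move=> ij; rewrite look_glue ?ij // ltnW.
set tau := mkseq _ n.
have sztau : size tau = n by rewrite size_mkseq.
have nth_tau i : i < n -> nth L0 tau i = look f NE i (n.-1 - i).
  by move=> lti; rewrite nth_mkseq.
apply/puzzleP/andP => [[nw ne so up down]|[/eqP eE /andP[/puzzleP[nw ne so up down]
  st]]].
  have eE : E = nu.
    apply: (@eq_from_nth _ L0) => [|i]; rewrite szE // => lti.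
    by rewrite -ne // lkW //=; lia.
  split; first by rewrite eE.
  apply/andP; split.
    apply/puzzleP; split.
    - by move=> j ltj; rewrite -lkf // nw ?nth_rcons ?szlam ?ltj // ltnW.
    - by move=> i lti; rewrite nth_tau.
    - move=> i lti; rewrite -lkf ?addn0 // so; last lia.
      by have -> : n.+1.-1 - i = (n.-1 - i).+1 by lia.
    - by move=> i j ltij; rewrite -!lkf //; apply: up; lia.
    - by move=> i j ltij; rewrite -!lkf //; [apply: down; lia | lia..].
  apply/and4P; split.
  - by rewrite -(lkW NW 0 n) // nw // nth_rcons szlam ltnn eqxx.
  - by rewrite sztau -(lkW South n 0) ?addn0 // so //= subnn.
  - apply/allP => i; rewrite mem_iota sztau => /andP[_ lti].
    have e : i + (n - i) = n by lia.
    by have := up i (n - i); rewrite !(lkW _ _ _ e) e /= eE; apply.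
  - apply/allP => i; rewrite mem_iota sztau => /andP[_ lti].
    have e : (i + (n.-1 - i)).+1 = n by lia.
    have := down i (n.-1 - i).
    by rewrite nth_tau // (lkW South) ?addnS // (lkW NW) // lkf e //; apply.
have /and4P[/eqP N0 /eqP Sn /allP oku /allP okd] := st.
rewrite sztau in Sn oku okd.
split.
- move=> j; rewrite ltnS leq_eqVlt => /orP[/eqP->|ltj].
    by rewrite lkW //= N0 nth_rcons szlam ltnn eqxx.
  by rewrite lkf // nw // nth_rcons szlam ltj.
- by move=> i lti; rewrite lkW /= ?eE //; lia.
- move=> i; rewrite ltnS leq_eqVlt => /orP[/eqP->|lti].
    by rewrite lkW ?addn0 //= Sn subnn.
  rewrite lkf ?addn0 // so //=.
  by have -> : n - i = (n.-1 - i).+1 by lia.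
- move=> i j; rewrite ltnS leq_eqVlt => /orP[/eqP ij|ltij].
    by rewrite !lkW //= eE; apply: oku; rewrite mem_iota; lia.
  by rewrite !lkf //; apply: up.
move=> i j; rewrite ltnS leq_eqVlt => /orP[/eqP ij|ltij].
  rewrite (lkW South) ?(lkW NW) ?lkf /=; try lia.
  have lti : i < n by lia.
  have := okd i; rewrite nth_tau // mem_iota => /(_ lti).
  by have -> : n.-1 - i = j by lia.
by rewrite !lkf //; [apply: down | lia..].
Qed.

Definition glue_tuples n (x : labeling n *
    (n.+1.-tuple label * n.+1.-tuple label * n.+1.-tuple label)) :=
  glue x.1 (fun s =>
    match s with NW => x.2.1.1 : seq label | NE => x.2.1.2 | South => x.2.2 end).

Lemma glue_tuples_bij n : bijective (@glue_tuples n).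
Proof.
pose edge_word (f : labeling n.+1) s := [tuple look f s (i : 'I_n.+1) (n - i) | i <
  n.+1].
exists (fun f : labeling n.+1 => ([ffun e : edge n => look f e.1 (cx e.2) (cy e.2)],
   (edge_word f NW, edge_word f NE, edge_word f South))) => [[f [[N E] S]]|f].
  have out s i : i < n.+1 -> look (glue_tuples (f, (N, E, S))) s i (n - i)
     = nth L0 (match s with NW => N : seq label | NE => E | South => S end) i.
    by move=> lti; rewrite look_glue ?subnKC ?ltnn // -ltnS.
  congr (_, (_, _, _)); last 3 first.
  - by apply: eq_from_tnth => i; rewrite tnth_mktuple out // (tnth_nth L0).
  - by apply: eq_from_tnth => i; rewrite tnth_mktuple out // (tnth_nth L0).
  - by apply: eq_from_tnth => i; rewrite tnth_mktuple out // (tnth_nth L0).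
  apply: labelingP => s i j ltij.
  rewrite (look_mk _ _ ltij) ffunE /=.
  by rewrite look_glue ?ltij // ltnW.
apply: labelingP => s i j; rewrite ltnS => leij; rewrite look_glue //.
case: ltnP => [ltij|geij]; first by rewrite (look_mk _ _ ltij) ffunE.
have lti : i < n.+1 by lia.
have -> : j = n - i by lia.
have wordE s' : nth L0 (edge_word f s') i = look f s' i (n - i).
  by rewrite -[i in LHS]/(val (Ordinal lti)) nth_mktuple.
by case: s; apply: wordE.
Qed.

(** A labeling of side [n.+1] is a labeling of side [n] together with three words of new labels;
    summing over the new words turns [puzzle_glue] into the recursion of [tri]. *)
Lemma puzzle_sum_rec n lam g nu d mu :
    size lam = n -> size nu = n.+1 ->
  \sum_(f : labeling n.+1) puzzle (rcons lam g) nu (d :: mu) f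
  = \sum_(tau <- words n)
      (\sum_(f : labeling n) puzzle lam tau mu f) * strip g nu tau d.
Proof.
move=> szlam sznu.
rewrite (reindex (@glue_tuples n)) /=; last exact: onW_bij (glue_tuples_bij n).
rewrite -(pair_bigA _ (fun f y =>
  puzzle (rcons lam g) nu (d :: mu) (glue_tuples (f, y)) : nat)) /=.
under [RHS]eq_bigr do rewrite big_distrl /=.
rewrite [RHS]exchange_big; apply: eq_bigr => f _.
rewrite -(pair_bigA _ (fun NE S =>
  puzzle (rcons lam g) nu (d :: mu) (glue_tuples (f, (NE, S))) : nat)) /=.
rewrite -(pair_bigA _ (fun N E =>
  \sum_S puzzle (rcons lam g) nu (d :: mu) (glue_tuples (f, (N, E, S))) : nat)) /=.
set tau := mkseq (fun i => look f NE i (n.-1 - i)) n.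
have sztau : size tau = n by rewrite size_mkseq.
transitivity (puzzle lam tau mu f * strip g nu tau d).
  rewrite strip_sum sztau // big_distrr -sum_tuple_words; apply: eq_bigr => N _.
  under eq_bigr do under eq_bigr do rewrite puzzle_glue ?size_tuple // -/tau.
  rewrite big_distrr -sum_tuple_words exchange_big; apply: eq_bigr => S _.
  have -> : \sum_(E : n.+1.-tuple label)
      ((tval E == nu) && (puzzle lam tau mu f && strip_ok g nu tau d N S) : nat)
    = \sum_(E <- words n.+1)
      (E == nu) * (puzzle lam tau mu f && strip_ok g nu tau d N S).
    by rewrite -sum_tuple_words; apply: eq_bigr => E _; rewrite -mulnb.
  by rewrite sum_nat_delta ?words_uniq ?mem_words ?sznu // -mulnb.
(* The NE side of [f] is the only word [t] for which [f] can be a puzzle, so the sum over [t] has a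
   single term. *)
rewrite -(sum_nat_delta (r := words n) (t := tau)
  (fun t => puzzle lam t mu f * strip g nu t d)) ?words_uniq ?mem_words ?sztau //.
apply: eq_big_seq => t; rewrite mem_words => /eqP szt.
have [->|tneq] := eqVneq t tau; first by rewrite mul1n.
have [/puzzleP[_ ne _ _ _]|] //= := boolP (puzzle lam t mu f).
case/eqP: tneq; apply: (@eq_from_nth _ L0) => [|i]; rewrite szt ?sztau // => lti.
by rewrite nth_mkseq // ne.
Qed.

Lemma puzzle_sum n lam mu nu : size lam = n -> size mu = n -> size nu = n ->
  \sum_(f : labeling n) puzzle lam mu nu f = tri (rev lam) mu nu.
Proof.
elim: n lam mu nu => [|n IH] lam mu nu.
  move=> /size0nil-> /size0nil-> /size0nil->.
  have f0 : labeling 0 by apply: finfun => -[_ [[[]]]].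
  rewrite (eq_bigr (fun=> 1)) => [|f _]; last first.
    by have /puzzleP-> // : puzzle_spec [::] [::] [::] f by split.
  rewrite sum_nat_const muln1 card_ffun card_prod.
  rewrite [#|{: upcell 0}|]eq_card0 ?muln0 ?expn0 // => p.
  by have := cell_lt p; rewrite ltn0.
case/lastP: lam => // lam g; case: nu => // d nu.
rewrite size_rcons => -[szlam] szmu [sznu].
rewrite puzzle_sum_rec // rev_rcons /= size_rev szlam.
by apply: eq_big_seq => tau; rewrite mem_words => /eqP sztau; rewrite IH.
Qed.

(* Green's theorem: the labels [0], [1], [10] carry the charges 1, 0, 1 on NW
   edges, 0, 0, 1 on NE edges and 1, 0, 0 on South edges. *)
Lemma strip_balance p nu tau d : strip p nu tau d != 0 ->
  (p != L1) + count_mem L10 tau = count_mem L10 nu + (d == L0).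
Proof.
elim: nu p tau => // n nu IH p tau.
(* In a piece of either orientation the NW charge is the sum of the other two; charges on shared
   edges then cancel. *)
have up x y z : allowed x y z -> (x != L1) = (y == L10) + (z == L0) :> nat.
  by case: x; case: y; case: z.
case: tau => [|s tau].
  case: nu {IH} => //=; rewrite eqb0 negbK => /up ->; lia.
have -> : strip p (n :: nu) (s :: tau) d = \sum_r \sum_p'
   allowed p n r * allowed p' s r * strip p' nu tau d by case: (nu).
rewrite sum_nat_eq0 negb_forall => /existsP[r].
rewrite sum_nat_eq0 negb_forall => /existsP[p'].
rewrite !muln_eq0 !negb_or !eqb0 !negbK => /andP[/andP[/up pnr /up psr] /IH].
by rewrite /=; lia.
Qed.

Lemma tri_balance lam nu mu : tri lam nu mu != 0 ->
  count (predC1 L1) lam = count_mem L10 nu + count_mem L0 mu.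
Proof.
elim: lam nu mu => [|g lam IH] nu [|d mu] //=; first by case: nu.
rewrite sum_nat_seq_neq0 => /hasP[tau _] /=.
rewrite muln_eq0 negb_or => /andP[/IH -> /strip_balance /=].
by lia.
Qed.

(** The outer strips see the NW and South sides only through [u] and [v]. Peeling them off leaves
    the corner triangles, whose cut [sg] runs over all words, including those with [10]. *)
Lemma tri_corner u v alpha beta alpha' beta' nu :
    size u = size v -> size alpha = size alpha' ->
    (forall sg, size sg = size alpha -> tri alpha sg beta = tri alpha' sg beta') ->
    size nu = size u + size alpha ->
  tri (u ++ alpha) nu (v ++ beta) = tri (u ++ alpha') nu (v ++ beta').
Proof.
move=> + sza corner; elim: u v nu => [|g u IH] [|d v] nu //; first by move=> _;
  apply: corner.
move=> [szuv] sznu /=.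
rewrite !size_cat -sza; apply: eq_big_seq => tau.
by rewrite mem_words => /eqP sztau; rewrite IH.
Qed.

(** * A line sweeping over a puzzle *)

Local Open Scope ring_scope.

Section LineWeights.

Variables (R : comNzRingType) (b : R).

(* The line goes from the top corner towards the bottom left, along NE, South
   and NW edges in the directions -60, 180 and 240 degrees; [wtE], [wtS], [wtN]
   are its weights there.  In [wt w q q' w'] the state changes from [w] to [w'],
   [q] is the label on the upper left of the line and [q'] on its lower right.
   The supports obey the charge conservation
     c w' - c w = w3 (c q - c q')     on NE edges,
                = w3 ^ 2 (c q - c q') on South edges,
                = c q' - c q          on NW edges,
   where w3 is a primitive cube root of unity and
   c 10 = - w3 * c 1 - w3 ^ 2 * c 0.  The values solve [up_flip], [down_flip]. *)
Definition wtE (w q q' w' : label) : R :=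
  match w, q, q', w' with
  | L0, L0, L0, L0 | L0, L0, L1, L10 | L1, L0, L0, L1 | L1, L0, L10, L10
  | L1, L1, L1, L1 | L10, L1, L0, L0 | L10, L1, L1, L10 | L10, L10, L0, L1
  | L10, L10, L10, L10 => 1
  | L10, L0, L0, L10 => - b
  | _, _, _, _ => 0
  end.

Definition wtN (w q q' w' : label) : R :=
  match w, q, q', w' with
  | L0, L0, L1, L1 | L0, L1, L1, L0 | L1, L0, L0, L1 | L1, L1, L0, L0
  | L1, L1, L10, L10 | L1, L10, L10, L1 | L10, L0, L0, L10 | L10, L1, L1, L10
  | L10, L10, L1, L1 => 1
  | L1, L1, L1, L1 => b
  | _, _, _, _ => 0
  end.

Definition wtS (w q q' w' : label) : R :=
  match w, q, q', w' with
  | L0, L0, L10, L1 | L0, L1, L10, L10 | L0, L10, L10, L0 | L1, L0, L0, L1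
  | L1, L1, L0, L10 | L1, L10, L0, L0 | L10, L0, L1, L1 | L10, L1, L1, L10
  | L10, L10, L1, L0 => 1
  | L0, L1, L1, L0 | L1, L1, L1, L1 | L1, L10, L10, L1 => b
  | _, _, _, _ => 0
  end.

Let ok x y z : R := (allowed x y z)%:R.

Let simp := (mul0r, mulr0, add0r, addr0, mul1r, mulr1).

(** The line moves across an upward triangle, from its NE and South edges to its NW edge. This is a
    finite identity, one for each choice of the three outer labels and the two end states. *)
Lemma up_flip w0 w1 p q' r' :
  \sum_q \sum_r \sum_w wtE w0 q q' w * ok p q r * wtS w r r' w1
  = \sum_p' wtN w0 p p' w1 * ok p' q' r'.
Proof.
rewrite !big_label /ok.
case: p; case: w0; case: q'; case: r'; case: w1 => /=; rewrite ?simp //; ring.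
Qed.

Lemma down_flip w0 w1 l t r' :
  \sum_r ok r l t * wtN w0 r r' w1
  = \sum_t' \sum_l' \sum_w wtS w0 t t' w * ok r' l' t' * wtE w l l' w1.
Proof.
rewrite !big_label /ok.
case: l; case: w0; case: t; case: r'; case: w1 => /=; rewrite ?simp //; ring.
Qed.

End LineWeights.

(** * Moving the line across a rhombus and across a strip *)

Section Line.

Variables (R : comNzRingType) (b : R).

Fixpoint line (wt : label -> label -> label -> label -> R) (w0 w1 : label)
    (v v' : seq label) : R :=
  match v, v' with
  | [::], [::] => (w0 == w1)%:R
  | q :: v, q' :: v' => \sum_w wt w0 q q' w * line wt w w1 v v'
  | _, _ => 0
  end.

Let lineE := line (wtE b).

Let ok x y z : R := (allowed x y z)%:R.

Lemma sum_delta (F : label -> R) w1 : \sum_w F w * (w == w1)%:R = F w1.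
Proof.
rewrite (bigD1 w1) //= eqxx mulr1 big1 ?addr0 // => w /negPf->.
by rewrite mulr0.
Qed.

Lemma sum_delta' (F : label -> R) w1 : \sum_w (w1 == w)%:R * F w = F w1.
Proof.
by under eq_bigr do rewrite mulrC eq_sym; rewrite sum_delta.
Qed.

(** The rhombus is an upward and a downward triangle sharing the edge [r]. By [down_flip] the path
    NE, NW becomes NE, South, NE; by [up_flip] its first two steps become NW. *)
Lemma rhombus_flip w0 w1 g s n' p2 :
  \sum_q \sum_w \sum_r \sum_p' wtE b w0 q n' w * ok g q r * ok p' s r * wtN b w p' p2 w1
  = \sum_g' \sum_w \sum_s' \sum_r'
      wtN b w0 g g' w * ok g' n' r' * ok p2 s' r' * wtE b w s s' w1.
Proof.
transitivity (\sum_t' \sum_l' \sum_w (\sum_q \sum_r \sum_w'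
    wtE b w0 q n' w' * ok g q r * wtS b w' r t' w) * (ok p2 l' t' * wtE b w s l' w1)).
  transitivity (\sum_q \sum_w \sum_r wtE b w0 q n' w * ok g q r *
      \sum_t' \sum_l' \sum_w2 wtS b w r t' w2 * ok p2 l' t' * wtE b w2 s l' w1).
    apply: eq_bigr => q _; apply: eq_bigr => w _; apply: eq_bigr => r _.
    rewrite -down_flip mulr_sumr; apply: eq_bigr => p' _.
    by rewrite !mulrA.
  symmetry.
  under eq_bigr do under eq_bigr do under eq_bigr do rewrite mulr_suml.
  under eq_bigr do under eq_bigr do rewrite exchange_big.
  under eq_bigr do rewrite exchange_big.
  rewrite exchange_big; apply: eq_bigr => q _.
  under eq_bigr do under eq_bigr do under eq_bigr do rewrite mulr_suml.
  under eq_bigr do under eq_bigr do rewrite exchange_big.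
  under eq_bigr do rewrite exchange_big.
  rewrite exchange_big [RHS]exchange_big; apply: eq_bigr => r _.
  under eq_bigr do under eq_bigr do under eq_bigr do rewrite mulr_suml.
  under eq_bigr do under eq_bigr do rewrite exchange_big.
  under eq_bigr do rewrite exchange_big.
  rewrite exchange_big; apply: eq_bigr => w _.
  rewrite mulr_sumr; apply: eq_bigr => t' _.
  rewrite mulr_sumr; apply: eq_bigr => l' _.
  rewrite mulr_sumr; apply: eq_bigr => w2 _.
  by rewrite !mulrA.
under eq_bigr do under eq_bigr do under eq_bigr do rewrite up_flip mulr_suml.
under eq_bigr do under eq_bigr do rewrite exchange_big.
under eq_bigr do rewrite exchange_big.
rewrite exchange_big; apply: eq_bigr => g' _.
under eq_bigr do rewrite exchange_big.
rewrite exchange_big; apply: eq_bigr => w _.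
rewrite exchange_big; apply: eq_bigr => s' _; apply: eq_bigr => r' _.
by rewrite !mulrA.
Qed.

Lemma strip_flip w0 w1 g sg nu' d' : size nu' = (size sg).+1 ->
  \sum_(nu <- words (size sg).+1) \sum_d \sum_w
     lineE w0 w nu nu' * (strip g nu sg d)%:R * wtS b w d d' w1
  = \sum_g' \sum_w wtN b w0 g g' w *
      \sum_(sg' <- words (size sg)) lineE w w1 sg sg' * (strip g' nu' sg' d')%:R.
Proof.
elim: sg w0 g nu' => [|s sg IH] w0 g [|n' nu'] // [].
  move=> /size0nil->; rewrite big_words_cons.
  under eq_bigr do rewrite big_seq1 /=.
  under [in RHS]eq_bigr do under eq_bigr do rewrite big_seq1 /= mulrA mulrAC.
  under [in RHS]eq_bigr do rewrite (sum_delta (fun w => _ * _)).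
  rewrite -up_flip; apply: eq_bigr => q _; apply: eq_bigr => d _.
  apply: eq_bigr => w _; congr (_ * _ * _).
  by rewrite /lineE /= sum_delta.
move=> sz.
pose G p2 w2 := \sum_(sg' <- words (size sg)) lineE w2 w1 sg sg' * (strip p2 nu' sg'
  d')%:R.
have IHG w p' : \sum_p2 \sum_w2 wtN b w p' p2 w2 * G p2 w2 =
    \sum_(nu <- words (size sg).+1) \sum_d \sum_w2
      lineE w w2 nu nu' * (strip p' nu sg d)%:R * wtS b w2 d d' w1.
  by rewrite IH.
(* The induction hypothesis first moves the line across the rest of the strip; the first rhombus is
   then moved across last. *)
transitivity (\sum_q \sum_w \sum_r \sum_p'
   wtE b w0 q n' w * ok g q r * ok p' s r * (\sum_p2 \sum_w2 wtN b w p' p2 w2 * G p2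
     w2)).
  rewrite big_words_cons; apply: eq_bigr => q _.
  symmetry.
  under [LHS]eq_bigr do under eq_bigr do under eq_bigr do rewrite IHG mulr_sumr.
  under eq_bigr do under eq_bigr do rewrite exchange_big.
  under eq_bigr do rewrite exchange_big.
  rewrite exchange_big; apply: eq_big_seq => nu; rewrite mem_words => sznu.
  under eq_bigr do under eq_bigr do under eq_bigr do rewrite mulr_sumr.
  under eq_bigr do under eq_bigr do rewrite exchange_big.
  under eq_bigr do rewrite exchange_big.
  rewrite exchange_big; apply: eq_bigr => d _.
  under eq_bigr do under eq_bigr do under eq_bigr do rewrite mulr_sumr.
  under eq_bigr do under eq_bigr do rewrite exchange_big.
  under eq_bigr do rewrite exchange_big.
  rewrite exchange_big; apply: eq_bigr => w _.
  case: nu sznu => // n1 nu sznu; rewrite /lineE [LHS]/= [X in _ * X * _]/=.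
  rewrite -/line natr_sum [line _ _ _ (q :: _) _]/= !mulr_suml; apply: eq_bigr => w2 _.
  rewrite mulr_sumr mulr_suml; apply: eq_bigr => r _.
  rewrite natr_sum mulr_sumr mulr_suml; apply: eq_bigr => p' _.
  by rewrite !natrM /ok; ring.
transitivity (\sum_p2 \sum_w2 (\sum_q \sum_w \sum_r \sum_p'
   wtE b w0 q n' w * ok g q r * ok p' s r * wtN b w p' p2 w2) * G p2 w2).
  symmetry.
  under eq_bigr do under eq_bigr do rewrite mulr_suml.
  under eq_bigr do rewrite exchange_big.
  rewrite exchange_big; apply: eq_bigr => q _.
  under eq_bigr do under eq_bigr do rewrite mulr_suml.
  under eq_bigr do rewrite exchange_big.
  rewrite exchange_big; apply: eq_bigr => w _.
  under eq_bigr do under eq_bigr do rewrite mulr_suml.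
  under eq_bigr do rewrite exchange_big.
  rewrite exchange_big; apply: eq_bigr => r _.
  under eq_bigr do under eq_bigr do rewrite mulr_suml.
  under eq_bigr do rewrite exchange_big.
  rewrite exchange_big; apply: eq_bigr => p' _.
  rewrite mulr_sumr; apply: eq_bigr => p2 _.
  rewrite mulr_sumr; apply: eq_bigr => w2 _.
  by rewrite !mulrA.
under eq_bigr do under eq_bigr do rewrite rhombus_flip mulr_suml.
under eq_bigr do rewrite exchange_big.
rewrite exchange_big; apply: eq_bigr => g' _.
under eq_bigr do under eq_bigr do rewrite mulr_suml.
under eq_bigr do rewrite exchange_big.
rewrite exchange_big; apply: eq_bigr => w _.
rewrite -/(words (size sg).+1) big_words_cons mulr_sumr.
under eq_bigr do under eq_bigr do rewrite mulr_suml.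
under eq_bigr do rewrite exchange_big.
rewrite exchange_big; apply: eq_bigr => s' _.
under eq_bigr do under eq_bigr do rewrite mulr_suml.
symmetry; rewrite mulr_sumr.
under [RHS]eq_bigr do under eq_bigr do under eq_bigr do rewrite mulr_sumr.
under [RHS]eq_bigr do under eq_bigr do rewrite exchange_big.
under [RHS]eq_bigr do rewrite exchange_big.
rewrite [RHS]exchange_big; apply: eq_big_seq => sg'; rewrite mem_words => szsg.
have -> : (strip g' (n' :: nu') (s' :: sg') d') =
   (\sum_r \sum_p' allowed g' n' r * allowed p' s' r * strip p' nu' sg' d')%N.
  by case: (nu').
rewrite /lineE /= mulr_suml mulr_sumr [RHS]exchange_big; apply: eq_bigr => w2 _.
rewrite natr_sum !mulr_sumr [RHS]exchange_big; apply: eq_bigr => r _.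
rewrite natr_sum !mulr_sumr; apply: eq_bigr => p' _.
by rewrite !natrM /ok; ring.
Qed.

End Line.

(** * Sweeping the line over the trapezoid *)

Section Line.

Variables (R : comNzRingType) (b : R).

(** Read backwards from the final state [L1]: if the upper left label is not [10], the only nonzero
    weights of [wtE] ending in [L1] keep both state and label. *)
Lemma lineE_transparent_in w tau tau' : L10 \notin tau ->
  line (wtE b) w L1 tau tau' = ((w == L1) && (tau == tau'))%:R.
Proof.
elim: tau w tau' => [|q tau IH] w [|q' tau'] //=; rewrite ?andbT ?andbF //.
rewrite inE negb_or => /andP[q10 tau10].
under eq_bigr do rewrite IH // -mulnb natrM mulrCA mulrC -mulrA.
rewrite (bigD1 L1) //= big1 => [|w' /negPf->]; last by rewrite !mulr0.
rewrite addr0 eqseq_cons.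
by case: w; case: q q10; case: q'; case: (tau == tau') => // _;
  rewrite ?(mulr0, mul0r, mulr1).
Qed.

Lemma lineE_transparent_out w tau tau' : L10 \notin tau' ->
  line (wtE b) L1 w tau tau' = ((w == L1) && (tau == tau'))%:R.
Proof.
elim: tau tau' => [|q tau IH] [|q' tau'] //=.
- by rewrite eq_sym andbT.
- by rewrite andbF.
- by rewrite andbF.
rewrite inE negb_or => /andP[q10 tau10].
rewrite (bigD1 L1) //= big1 => [|w']; last first.
  by case: w'; case: q; case: q' q10 => // *; rewrite mul0r.
rewrite addr0 IH // eqseq_cons.
by case: q; case: q' q10 => // *; rewrite ?(mul1r, mul0r) //= ?andbF.
Qed.

Lemma sum_words_delta (F : seq label -> R) n t : size t = n ->
  \sum_(tau <- words n) (tau == t)%:R * F tau = F t.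
Proof.
move=> szt; rewrite (bigD1_seq t) ?words_uniq ?mem_words ?szt //= eqxx mul1r.
by rewrite big1 ?addr0 // => tau /negPf->; rewrite mul0r.
Qed.

Section Sweep.

Variables alpha beta : seq label.
Hypothesis balanced : count (predC1 L1) alpha = count_mem L0 beta.

(** Balance leaves no charge for the cut: [tri_balance] excludes [10] from every [tau] that
    contributes, so the line passes unchanged. *)
Lemma corner_transparent w tau' : size tau' = size alpha ->
  \sum_(tau <- words (size alpha))
     line (wtE b) w L1 tau tau' * (tri alpha tau beta)%:R
  = (w == L1)%:R * (tri alpha tau' beta)%:R.
Proof.
move=> sz.
rewrite -(sum_words_delta (fun t => (w == L1)%:R * (tri alpha t beta)%:R) sz).
apply: eq_bigr => tau _.
have [->|nz] := eqVneq (tri alpha tau beta) 0%N; first by rewrite !mulr0.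
rewrite lineE_transparent_in; first by rewrite -mulnb natrM mulrCA mulrA.
have := tri_balance nz; rewrite balanced -has_pred1 has_count; lia.
Qed.

(** Each strip is crossed by [strip_flip], from the outside inwards. What remains of the line at the
    cut disappears by [corner_transparent]. *)
Lemma tri_sweep w0 u delta tau' : size u = size delta ->
    size tau' = (size u + size alpha)%N ->
  \sum_(tau <- words (size u + size alpha)) \sum_(v <- words (size u)) \sum_w
     line (wtE b) w0 w tau tau' * line (wtS b) w L1 v delta
       * (tri (u ++ alpha) tau (v ++ beta))%:R
  = \sum_(u' <- words (size u))
     line (wtN b) w0 L1 u u' * (tri (u' ++ alpha) tau' (delta ++ beta))%:R.
Proof.
elim: u w0 delta tau' => [|g u IH] w0 [|d' delta] tau' //.
  move=> _ sz; rewrite big_seq1 -corner_transparent //; apply: eq_bigr => tau _.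
  rewrite big_seq1.
  by under eq_bigr do rewrite mulrAC; rewrite sum_delta.
move=> [szu] sz.
have szua : size (u ++ alpha) = (size u + size alpha)%N by rewrite size_cat.
transitivity (\sum_(rho <- words (size u + size alpha)) \sum_(v <- words (size u))
  \sum_w2
   line (wtS b) w2 L1 v delta * (tri (u ++ alpha) rho (v ++ beta))%:R *
   \sum_(tau <- words (size u + size alpha).+1) \sum_d \sum_w
     line (wtE b) w0 w tau tau' * (strip g tau rho d)%:R * wtS b w d d' w2).
  rewrite [in words _]/=.
  symmetry.
  under [LHS]eq_bigr do under eq_bigr do under eq_bigr do rewrite mulr_sumr.
  under [LHS]eq_bigr do under eq_bigr do rewrite exchange_big.
  under [LHS]eq_bigr do rewrite exchange_big.
  rewrite [LHS]exchange_big; apply: eq_bigr => tau _.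
  rewrite [RHS]big_words_cons.
  under [LHS]eq_bigr do under eq_bigr do under eq_bigr do rewrite mulr_sumr.
  under [LHS]eq_bigr do under eq_bigr do rewrite exchange_big.
  under [LHS]eq_bigr do rewrite exchange_big.
  rewrite [LHS]exchange_big; apply: eq_bigr => d _.
  rewrite [LHS]exchange_big; apply: eq_bigr => v _.
  under [LHS]eq_bigr do under eq_bigr do rewrite mulr_sumr.
  under [LHS]eq_bigr do rewrite exchange_big.
  rewrite [LHS]exchange_big; apply: eq_bigr => w _.
  rewrite /= szua natr_sum [RHS]mulr_sumr; apply: eq_bigr => rho _.
  rewrite natrM mulr_sumr mulr_suml; apply: eq_bigr => w2 _.
  by ring.
transitivity (\sum_g' \sum_w \sum_(rho' <- words (size u + size alpha))
   wtN b w0 g g' w * (strip g' tau' rho' d')%:R *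
   \sum_(rho <- words (size u + size alpha)) \sum_(v <- words (size u)) \sum_w2
     line (wtE b) w w2 rho rho' * line (wtS b) w2 L1 v delta
       * (tri (u ++ alpha) rho (v ++ beta))%:R).
  symmetry.
  under [LHS]eq_bigr do under eq_bigr do under eq_bigr do rewrite mulr_sumr.
  under [LHS]eq_bigr do under eq_bigr do rewrite exchange_big.
  under [LHS]eq_bigr do rewrite exchange_big.
  rewrite [LHS]exchange_big; apply: eq_big_seq => rho.
  rewrite mem_words => /eqP szrho.
  under [LHS]eq_bigr do under eq_bigr do under eq_bigr do rewrite mulr_sumr.
  under [LHS]eq_bigr do under eq_bigr do rewrite exchange_big.
  under [LHS]eq_bigr do rewrite exchange_big.
  rewrite [LHS]exchange_big; apply: eq_bigr => v _.
  under [LHS]eq_bigr do under eq_bigr do under eq_bigr do rewrite mulr_sumr.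
  under [LHS]eq_bigr do under eq_bigr do rewrite exchange_big.
  under [LHS]eq_bigr do rewrite exchange_big.
  rewrite [LHS]exchange_big; apply: eq_bigr => w2 _.
  rewrite -szrho strip_flip ?szrho //.
  rewrite mulr_sumr; apply: eq_bigr => g' _.
  rewrite mulr_sumr; apply: eq_bigr => w _.
  rewrite !mulr_sumr; apply: eq_bigr => rho' _.
  by ring.
rewrite [in words _]/= big_words_cons; apply: eq_bigr => g' _.
transitivity (\sum_w \sum_(rho' <- words (size u + size alpha)) \sum_(u' <- words
  (size u))
    wtN b w0 g g' w * (strip g' tau' rho' d')%:R * (line (wtN b) w L1 u u' *
      (tri (u' ++ alpha) rho' (delta ++ beta))%:R)).
  apply: eq_bigr => w _; apply: eq_big_seq => rho'; rewrite mem_words => /eqP szr.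
  by rewrite IH // mulr_sumr.
under [LHS]eq_bigr do rewrite exchange_big.
rewrite exchange_big; apply: eq_big_seq => u'; rewrite mem_words => /eqP szu'.
rewrite /= size_cat szu' natr_sum mulr_suml; apply: eq_bigr => w _.
rewrite mulr_sumr; apply: eq_bigr => rho' _.
by rewrite natrM; ring.
Qed.

End Sweep.

End Line.

(** * Comparing the lines on the South and NW sides *)

Section Rev.

Variables (R : comNzRingType) (b : R).

Lemma line_rcons wt w0 w1 v v' q q' : size v = size v' ->
  line wt w0 w1 (rcons v q) (rcons v' q')
  = \sum_w line wt w0 w v v' * wt w q q' w1 :> R.
Proof.
elim: v v' w0 => [|p v IH] [|p' v'] w0 //=.
  by rewrite sum_delta sum_delta'.
case=> sz; under eq_bigr do rewrite IH // mulr_sumr.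
rewrite exchange_big; apply: eq_bigr => w _.
by rewrite mulr_suml; apply: eq_bigr => w' _; rewrite mulrA.
Qed.

(* On binary words the line cannot come back to the state [1] from the state
   [0] on the South side, nor from the state [10] on the NW side. *)
Lemma lineS_dead v delta : line (wtS b) L0 L1 v (bits delta) = 0.
Proof.
elim: delta v => [|q' delta IH] [|q v] //=; rewrite big_label /= IH.
by case: q; case: q' => /=; rewrite !(mul0r, mulr0, addr0).
Qed.

Lemma lineN_dead u u' : line (wtN b) L10 L1 (bits u) u' = 0.
Proof.
elim: u u' => [|q u IH] [|q' u'] //=; rewrite big_label /= IH.
by case: q; case: q' => /=; rewrite !(mul0r, mulr0, addr0).
Qed.

(** Traversed backwards, and with its two sides exchanged, the South line on a binary word is the NW
    line; the South state [10] plays the role of the NW state [0]. *)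
Lemma lineS_rev v delta : size v = size delta ->
  line (wtS b) L1 L1 v (bits delta) = line (wtN b) L1 L1 (rev (bits delta)) (rev v)
  /\ line (wtS b) L10 L1 v (bits delta) = line (wtN b) L1 L0 (rev (bits delta)) (rev v).
Proof.
elim: delta v => [|q' delta IH] [|q v] //= [sz].
have [IH1 IH10] := IH _ sz.
rewrite !rev_cons !line_rcons ?size_rev ?size_map // !big_label lineS_dead IH1 IH10.
by split; case: q; case: q' => /=; rewrite !(mul0r, mulr0, addr0, add0r, mul1r,
  mulr1) // mulrC.
Qed.

End Rev.

Lemma sum_words_rev (R : nmodType) n (F : seq label -> R) :
  \sum_(v <- words n) F (rev v) = \sum_(v <- words n) F v.
Proof.
rewrite -(big_map rev predT); apply: perm_big; apply: uniq_perm.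
- by rewrite map_inj_uniq ?words_uniq //; apply: can_inj revK.
- exact: words_uniq.
move=> v; rewrite -[v in LHS]revK mem_map; last exact: can_inj revK.
by rewrite !mem_words size_rev.
Qed.

(** * The hopping operators *)

(* With [w = true], [hop k w u F] is the sum of [F] over the words obtained from
   [u] by letting all ones but [k] move one step to the right.  The value
   [w = false] means that a one is being carried. *)
Fixpoint hop (k : nat) (w : bool) (u : seq bool) (F : seq bool -> int) : int :=
  match u, w with
  | [::], true => if k is 0 then F [::] else 0
  | [::], false => 0
  | false :: u', true => hop k true u' (F \o cons false)
  | true :: u', true =>
      (if k is k'.+1 then hop k' true u' (F \o cons true) else 0)
      + hop k false u' (F \o cons false)
  | false :: u', false => hop k true u' (F \o cons true)
  | true :: u', false => hop k false u' (F \o cons true)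
  end.

Lemma hopD k w u F G : hop k w u (fun x => F x + G x) = hop k w u F + hop k w u G.
Proof.
elim: u k w F G => [|[] u IH] k [] F G /=; rewrite ?addr0 //.
- by case: k.
- by rewrite (IH k false); case: k => [|k]; rewrite ?IH; ring.
- by rewrite (IH k false).
- by rewrite (IH k true).
- by rewrite (IH k true).
Qed.

Lemma hopN k w u F : hop k w u (fun x => - F x) = - hop k w u F.
Proof.
elim: u k w F => [|[] u IH] k [] F /=; rewrite ?oppr0 //.
- by case: k; rewrite // oppr0.
- by rewrite (IH k false); case: k => [|k]; rewrite ?IH; ring.
- by rewrite (IH k false).
- by rewrite (IH k true).
- by rewrite (IH k true).
Qed.

(** The sum of the zero-based positions of the ones: each one is counted once for every letter
    before it. *)
Fixpoint pos (u : seq bool) : nat :=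
  if u is _ :: u' then (pos u' + count id u')%N else 0.

Lemma eq_hop k w u F G :
  (forall x, size x = size u -> count id x = (count id u + ~~ w)%N ->
     (pos x + k = pos u + count id u)%N -> F x = G x) ->
  hop k w u F = hop k w u G.
Proof.
elim: u k w F G => [|[] u IH] k [] F G FG //=.
- by case: k FG => // FG; apply: FG.
- congr (_ + _).
    case: k FG => // k FG; apply: IH => x szx cx px; apply: FG => /=; lia.
  apply: IH => x szx cx px; apply: FG => /=; lia.
- apply: IH => x szx cx px; apply: FG => /=; lia.
- apply: IH => x szx cx px; apply: FG => /=; lia.
- apply: IH => x szx cx px; apply: FG => /=; lia.
Qed.

Lemma hop0 k w u : hop k w u (fun=> 0) = 0.
Proof.
elim: u k w => [|[] u IH] k [] //=; first by case: k.
by rewrite IH; case: k => [|k]; rewrite ?IH addr0.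
Qed.

Local Ltac inst IHs k l :=
  have [[/= ? ?] [/= ? ?]] := IHs k l true;
  have [[/= ? ?] [/= ? ?]] := IHs k l false.

Definition pred_idx (f : nat -> int) (k : nat) : int := if k is k'.+1 then f k' else 0.

(* In generating functions with parameters [b], [b'] for [k], [l], this is the
   RTT relation for the R-matrix that fixes the states (1, 1) and (0, 0) and is
   [[1, 0], [b - b', 1]] on the states (1, 0), (0, 1). *)
Lemma hop_exchange k l u F :
  [/\ hop k true u (fun x => hop l true x F) = hop l true u (fun x => hop k true x F),
      hop k true u (fun x => hop l false x F) = hop l true u (fun x => hop k false x F),
      hop k false u (fun x => hop l false x F) = hop l false u (fun x => hop k false
        x F)
    & hop k false u (fun x => hop l true x F)
        + pred_idx (fun k' => hop k' true u (fun x => hop l false x F)) k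
      = hop l false u (fun x => hop k true x F)
        + pred_idx (fun l' => hop k true u (fun x => hop l' false x F)) l].
Proof.
elim: u k l F => [|s u IH] k l F.
  by split; case: k => [|[|k]]; case: l => [|[|l]] //=; rewrite ?addr0.
have [TT TF FF FT] : [/\ forall k l F, _, forall k l F, _, forall k l F, _ & forall k
  l F, _] :=
  And4 (fun k l F => let: And4 h _ _ _ := IH k l F in h)
   (fun k l F => let: And4 _ h _ _ := IH k l F in h)
   (fun k l F => let: And4 _ _ h _ := IH k l F in h)
   (fun k l F => let: And4 _ _ _ h := IH k l F in h).
have IHs k' l' b :=
  conj (conj (TT k' l' (F \o cons b)) (TF k' l' (F \o cons b)))
    (conj (FF k' l' (F \o cons b)) (FT k' l' (F \o cons b))).
clear TT TF FF FT.
case: s; split; case: k => [|k]; case: l => [|l]; rewrite /= /comp /= ?hopD ?hop0.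
all: try (inst IHs 0%N 0%N; lia).
all: try (inst IHs 0%N l; inst IHs 0%N l.+1;  lia).
all: try (inst IHs k 0%N; inst IHs k.+1 0%N;  lia).
all: try (inst IHs k l; inst IHs k l.+1; inst IHs k.+1 l; inst IHs k.+1 l.+1;  lia).
(* Here [pred_idx] has lowered [k] once and the leading one in [hop] lowers it again, so one more
   case split is needed. *)
- by case: k => [|k]; [inst IHs 0%N 0%N; inst IHs 1%N 0%N | inst IHs k.+1 0%N;
  inst IHs k.+2 0%N]; lia.
- case: k => [|k]; [inst IHs 0%N l.+1; inst IHs 1%N l; inst IHs 1%N l.+1
    | inst IHs k.+1 l.+1; inst IHs k.+2 l; inst IHs k.+2 l.+1]; lia.
Qed.

(** On a binary word the state [1] is an idle line and [0] a line carrying a one, while [10] is dead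
    by [lineN_dead]. The weight ['X] occurs exactly when a one stays in place, so its exponent is
    the index of [hop]. *)
Lemma coef_line k w u (F : seq label -> int) :
  (\sum_(u' <- words (size u))
     line (wtN 'X) (bit_label w) L1 (bits u) u' * (F u')%:P)`_k
  = hop k w u (F \o bits).
Proof.
elim: u k w F => [|s u IH] k w F.
  rewrite big_seq1 /=; case: w => /=; rewrite ?mul0r ?coef0 // mul1r coefC.
  by case: k.
have step q :
    \sum_(u' <- words (size u))
      line (wtN 'X) (bit_label w) L1 (bits (s :: u)) (q :: u') * (F (q :: u'))%:P
  = \sum_w' wtN 'X (bit_label w) (bit_label s) q w' *
      \sum_(u' <- words (size u))
        line (wtN 'X) w' L1 (bits u) u' * (F (q :: u'))%:P.
  rewrite /=; under eq_bigr do rewrite mulr_suml.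
  rewrite exchange_big; apply: eq_bigr => w' _; rewrite mulr_sumr.
  by apply: eq_bigr => u' _; rewrite mulrA.
rewrite big_words_cons; under eq_bigr do rewrite step.
rewrite big_label !big_label.
have dead q : \sum_(u' <- words (size u))
    line (wtN 'X) L10 L1 (bits u) u' * (F (q :: u'))%:P = 0.
  by rewrite big1_seq // => u' _; rewrite lineN_dead mul0r.
have IH1 j q : (\sum_(u' <- words (size u))
    line (wtN 'X) L1 L1 (bits u) u' * (F (q :: u'))%:P)`_j
  = hop j true u ((F \o cons q) \o bits) := IH j true (F \o cons q).
have IH0 j q : (\sum_(u' <- words (size u))
    line (wtN 'X) L0 L1 (bits u) u' * (F (q :: u'))%:P)`_j
  = hop j false u ((F \o cons q) \o bits) := IH j false (F \o cons q).
case: w {step}; case: s; rewrite /= !dead !(mul0r, mulr0, addr0, add0r, mul1r) ?coefD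
  ?coefXM ?IH1 ?IH0 //.
by rewrite addrC; case: k.
Qed.

(** This is the coefficient of ['X^k] in [tri_sweep], with the line starting and ending in state
    [1]. *)
Lemma hop_sym alpha beta nu k u v :
    count (predC1 L1) alpha = count_mem L0 beta -> L10 \notin nu ->
    size u = size v -> size nu = (size u + size alpha)%N ->
  let S x y : int := (tri (bits x ++ alpha) nu (rev (bits y) ++ beta))%:R in
  hop k true u (fun x => S x v) = hop k true v (fun y => S u y).
Proof.
move=> bal nu10 szuv sznu S.
have szb x : size (bits x) = size x by rewrite size_map.
pose P x y : int := (tri (x ++ alpha) nu (rev y ++ beta))%:R.
rewrite -(coef_line k true u (fun x => P x (bits v))).
rewrite -(coef_line k true v (fun y => P (bits u) y)); congr ((_ : {poly int})`_k).
have := @tri_sweep _ 'X alpha beta bal L1 (bits u) (rev (bits v)) nu.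
rewrite size_rev !szb => /(_ int szuv sznu).
have -> : \sum_(u' <- words (size u)) line (wtN 'X) L1 L1 (bits u) u' *
      (tri (u' ++ alpha) nu (rev (bits v) ++ beta))%:R
  = \sum_(u' <- words (size u)) line (wtN 'X) L1 L1 (bits u) u' * (P u' (bits v))%:P.
  by apply: eq_bigr => u' _; rewrite /P rmorph_nat.
move=> <-; rewrite -szuv -[RHS]sum_words_rev [LHS]exchange_big; apply: eq_big_seq => y.
rewrite mem_words => /eqP szy.
(* Since [nu] has no [10], the line is transparent along the NE side and reaches the South side in
   state [1]. *)
transitivity ((\sum_w \sum_(tau <- words (size u + size alpha)) (tau == nu)%:R *
  ((w == L1)%:R * (line (wtS 'X) w L1 y (bits (rev v)) *
    (tri (bits u ++ alpha) tau (y ++ beta))%:R))) : {poly int}).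
  rewrite exchange_big; apply: eq_bigr => tau _; apply: eq_bigr => w _.
  by rewrite lineE_transparent_out // -mulnb natrM /bits map_rev; ring.
under eq_bigr do rewrite sum_words_delta //.
rewrite (bigD1 L1) // eqxx mul1r big1 /= ?addr0; last first.
  by move=> w /negPf->; rewrite mul0r.
have szr : size y = size (rev v) by rewrite size_rev szy.
rewrite (lineS_rev 'X szr).1 /bits map_rev !revK /P rmorph_nat revK.
by [].
Qed.

Lemma hop_Fubini k w u l w' v (G : seq bool -> seq bool -> int) :
  hop k w u (fun x => hop l w' v (G x)) = hop l w' v (fun y => hop k w u (G^~ y)).
Proof.
elim: u k w G => [|[] u IH] k [] G /=; rewrite /comp ?hop0 ?IH //.
- by case: k; rewrite ?hop0.
- by rewrite hopD; case: k => [|k]; rewrite ?IH ?hop0.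
Qed.

(** * Triangularity, and the sorted word as a cyclic vector *)

Lemma hop_all_move u G :
  hop 0 false (u ++ [:: false]) G = G (true :: u)
  /\ hop 0 true (u ++ [:: false]) G = G (false :: u).
Proof.
elim: u G => [|[] u IH] G //=; rewrite ?add0r.
  by rewrite !(IH _).1.
by rewrite !(IH _).2.
Qed.

Lemma pos_cat s t : pos (s ++ t) = (pos s + size s * count id t + pos t)%N.
Proof. by elim: s => //= _ s ->; rewrite count_cat; lia. Qed.

(* Triangularity: among the words reached when exactly [z] ones stay, the one on
   the right is the only one with at least [z] leading ones. *)
Lemma hop_leading z u F :
  (forall x, size x = (z + size u).+1 -> count id x = (z + count id u)%N ->
     pos x = pos (nseq z true ++ false :: u) -> (find negb x < z)%N -> F x = 0) ->
  hop z true (nseq z true ++ u ++ [:: false]) F = F (nseq z true ++ false :: u).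
Proof.
elim: z F => [|z IH] F Fz /=; first by rewrite (hop_all_move u F).2.
rewrite IH => [|x szx cx px fx]; last by apply: Fz => //=; rewrite ?szx ?cx ?px //;
  rewrite !count_cat /=; rewrite ?count_nseq; lia.
(* If the first one moves, the result begins with a zero; it has no leading ones and [F] vanishes
   there. *)
rewrite -[X in _ + X = _](_ : 0 = _) ?addr0 //.
rewrite -(hop0 z.+1 false (nseq z true ++ u ++ [:: false])).
apply: eq_hop => x; rewrite !size_cat !count_cat size_nseq count_nseq /= => szx cx px.
rewrite /comp Fz //=; try lia.
move: px; rewrite !pos_cat !count_cat size_nseq !count_nseq /=; nia.
Qed.

Fixpoint hops (ks : seq nat) (u : seq bool) (F : seq bool -> int) : int :=
  if ks is k :: ks' then hop k true u (fun x => hops ks' x F) else F u.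

Lemma hops_rcons ks k u F : hops (rcons ks k) u F = hops ks u (fun x => hop k true x F).
Proof.
elim: ks u => //= l ks IH u; apply: eq_hop => x _ _ _; exact: IH.
Qed.

Lemma eq_hops ks u F G :
  (forall x, size x = size u -> count id x = count id u -> F x = G x) ->
  hops ks u F = hops ks u G.
Proof.
elim: ks u => [|k ks IH] u FG /=; first exact: FG.
apply: eq_hop => x szx cx _; apply: IH => y szy cy; apply: FG; first by rewrite szy.
by rewrite cy cx addn0.
Qed.

Lemma hops_comm ks k u F :
  hops ks u (fun x => hop k true x F) = hop k true u (fun x => hops ks x F).
Proof.
elim: ks u => //= l ks IH u.
rewrite (eq_hop (G := fun x => hop k true x (fun y => hops ks y F))).
  by have [-> _ _ _] := hop_exchange l k u (fun y => hops ks y F).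
by move=> x _ _ _; rewrite IH.
Qed.

Lemma hops_rev ks u F : hops (rev ks) u F = hops ks u F.
Proof.
elim: ks u F => //= k ks IH u F.
by rewrite rev_cons hops_rcons IH hops_comm.
Qed.

Lemma hopsN ks u F : hops ks u (fun x => - F x) = - hops ks u F.
Proof.
by elim: ks u => //= k ks IH u; rewrite -hopN; apply: eq_hop => x _ _ _.
Qed.

Lemma hops0 ks u : hops ks u (fun=> 0) = 0.
Proof.
elim: ks u => //= k ks IH u; rewrite -[RHS](hop0 k true u).
by apply: eq_hop => x _ _ _.
Qed.

Lemma nseq_false u : count id u = 0%N -> u = nseq (size u) false.
Proof. by elim: u => // -[] u IH //= cu; rewrite -IH. Qed.

Lemma leading_ones u :
  (exists w, u = nseq (find negb u) true ++ false :: w) \/ u = nseq (size u) true.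
Proof.
elim: u => [|[] u IH] /=; first by right.
  by case: IH => [[w e]|e]; [left; exists w; rewrite {1}e | right; rewrite {1}e].
by left; exists u.
Qed.

Definition sorted_bits c0 c1 := nseq c1 true ++ nseq c0 false.

Lemma hops_cyclic c0 c1 F :
  (forall ks, hops ks (sorted_bits c0 c1) F = 0) ->
  forall u, size u = (c1 + c0)%N -> count id u = c1 -> F u = 0.
Proof.
move=> + u; have [n] := ubnP (pos u).
elim: n F u => // n IHn F u; rewrite ltnS => pos_u killed.
have [z] := ubnP (find negb u).
elim: z u pos_u => // z IHz u pos_u; rewrite ltnS => zu szu cu.
have [[w eu]|eu] := leading_ones u; last first.
  have c00 : c0 = 0%N by move: szu cu; rewrite eu size_nseq count_nseq /=; lia.
  rewrite eu szu -(killed [::]) /= /sorted_bits c00 cats0 addn0 //.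
set y := find negb u in eu zu.
have [w0|w_gt0] := posnP (count id w).
  rewrite -(killed [::]) /= /sorted_bits eu (nseq_false w0).
  move: szu cu; rewrite eu size_cat count_cat size_nseq count_nseq /= w0 => szu cu.
  congr F; rewrite -[false :: _]/(nseq (size w).+1 false).
  by congr (nseq _ _ ++ nseq _ _); lia.
move: szu cu; rewrite eu size_cat count_cat size_nseq count_nseq /= => szu cu.
(* Moving the first zero of [u] to the end lowers [pos], since [w] contains a one. Hopping back with
   [y] ones fixed gives [u] plus words with the same [pos] and fewer leading ones, where the inner
   induction applies. *)
rewrite -hop_leading.
  apply: (IHn (fun x => hop y true x F)).
  - move: pos_u; rewrite eu !pos_cat /= !count_cat size_nseq /=; lia.
  - by move=> ks; rewrite -hops_rcons killed.
  - by rewrite !size_cat size_nseq /=; lia.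
  - by rewrite !count_cat count_nseq /=; lia.
move=> x szx cx px fx; apply: IHz; try lia.
by rewrite px -eu.
Qed.

Section Symmetry.

Variables (c0 c1 : nat) (S : seq bool -> seq bool -> int).
Hypothesis hop_sym : forall k u v, size u = (c1 + c0)%N -> size v = (c1 + c0)%N ->
  hop k true u (S^~ v) = hop k true v (S u).

(* The difference [D] is antisymmetric, while [D_hops] and the commutation of
   the operators give [hops ks e (D^~ e) = hops ks e (D e)]; so both vanish for
   [e] sorted, and cyclicity does the rest. *)
Let D u v := S u v - S v u.

Let D_hop k u v : size u = (c1 + c0)%N -> size v = (c1 + c0)%N ->
  hop k true u (D^~ v) = hop k true v (D u).
Proof.
by move=> szu szv; rewrite /D !hopD !hopN hop_sym // -(hop_sym k szv szu) //; ring.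
Qed.

Let D_hops ks u v : size u = (c1 + c0)%N -> size v = (c1 + c0)%N ->
  hops ks u (D^~ v) = hops ks v (D u).
Proof.
(* Passing operators from one argument to the other reverses their order; commutativity, through
   [hops_rev], restores it. *)
move=> szu szv; rewrite -[RHS]hops_rev; elim: ks u szu => //= k ks IH u szu.
rewrite rev_cons hops_rcons.
transitivity (hop k true u (fun x => hops (rev ks) v (D x))).
  by apply: eq_hop => x szx _ _; rewrite IH // szx.
transitivity (hops (rev ks) v (fun y => hop k true u (D^~ y))).
  elim: (rev ks) v {IH szv} => //= l ms IH v.
  rewrite hop_Fubini; apply: eq_hop => y _ _ _; exact: IH.
by apply: eq_hops => y szy _; apply: D_hop; rewrite ?szy.
Qed.

Lemma symmetric_of_hop u v : size u = (c1 + c0)%N -> size v = (c1 + c0)%N ->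
  count id u = c1 -> count id v = c1 -> S u v = S v u.
Proof.
pose e := sorted_bits c0 c1.
have sze : size e = (c1 + c0)%N by rewrite size_cat !size_nseq.
have ce : count id e = c1 by rewrite count_cat !count_nseq /=; lia.
have De x : size x = (c1 + c0)%N -> count id x = c1 -> D x e = 0.
  apply: hops_cyclic (D^~ e) _ x => ks.
  have : hops ks e (D^~ e) = - hops ks e (D^~ e).
    by rewrite {1}D_hops // -hopsN; apply: eq_hops => x _ _; rewrite /D; ring.
  rewrite -/e; set h := hops _ _ _; lia.
move=> szu szv cu cv.
suff : D u v = 0 by rewrite /D; lia.
apply: (hops_cyclic (F := D^~ v)) szu cu => ks.
(* On the other argument the operators act on [D e], with [e] sorted, which is zero on this content
   by [De] and antisymmetry. *)
rewrite D_hops // -[RHS](hops0 ks v); apply: eq_hops => x szx cx.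
rewrite -/e; have := De x; rewrite szx cx => /(_ szv cv); rewrite /D; lia.
Qed.

End Symmetry.

Local Close Scope ring_scope.

(** * Symmetry *)

Lemma count_bitsC s : count (predC1 L1) (bits s) = count_mem L0 (bits s).
Proof. by elim: s => //= -[] s ->. Qed.

Lemma count_bits s : count_mem L0 (bits s) + count id s = size s.
Proof. by elim: s => //= -[] s <- /=; lia. Qed.

Lemma bits_no10 s : L10 \notin bits s.
Proof. by elim: s => // -[] s IH; rewrite inE negb_or. Qed.

Lemma tri_swap alpha beta nu c0 c1 gamma delta :
    count (predC1 L1) alpha = count_mem L0 beta -> L10 \notin nu ->
    size nu = c1 + c0 + size alpha ->
    size gamma = c1 + c0 -> size delta = c1 + c0 ->
    count id gamma = c1 -> count id delta = c1 ->
  tri (bits (rev gamma) ++ alpha) nu (bits delta ++ beta)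
  = tri (bits (rev delta) ++ alpha) nu (bits gamma ++ beta).
Proof.
move=> bal nu10 sznu szg szd cg cd.
pose S x y : int := (tri (bits x ++ alpha) nu (rev (bits y) ++ beta))%:R%R.
have S_sym : S (rev gamma) (rev delta) = S (rev delta) (rev gamma).
  apply: (@symmetric_of_hop c0 c1); rewrite ?size_rev ?count_rev //.
  by move=> k u v szu szv; apply: hop_sym; rewrite ?szu ?szv.
by move: S_sym; rewrite /S -!/(bits _) -[rev delta]revK;
  rewrite /bits !map_rev !revK; lia.
Qed.

(** Equal contents use up the whole charge, so both sides vanish when [sg] contains [10]; otherwise
    this is [tri_swap] with an empty corner. *)
Lemma tri_corner_comm alpha beta sg a0 a1 :
    size alpha = a1 + a0 -> size beta = a1 + a0 ->
    count id alpha = a1 -> count id beta = a1 -> size sg = a1 + a0 ->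
  tri (bits (rev alpha)) sg (bits beta) = tri (bits (rev beta)) sg (bits alpha).
Proof.
move=> sza szb ca cb szs.
have [sg10|sg10] := boolP (L10 \in sg).
  have vanish x y : size x = a1 + a0 -> size y = a1 + a0 -> count id x = a1 ->
      count id y = a1 -> tri (bits (rev x)) sg (bits y) = 0.
    move=> szx szy cx cy; apply/eqP; apply: contraTT sg10 => /tri_balance.
    rewrite -has_pred1 has_count.
    have := count_bits (rev x); have := count_bits y; rewrite size_rev count_rev.
    by rewrite count_bitsC; lia.
  by rewrite !vanish.
have := @tri_swap [::] [::] sg a0 a1 alpha beta erefl sg10.
by rewrite !cats0 addn0; apply.
Qed.

Lemma Tri_tri a c alpha beta gamma delta nu :
    size alpha = a -> size beta = a -> size gamma = c -> size delta = c ->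
    size nu = a + c ->
  Tri (a + c) (alpha ++ gamma) nu (delta ++ beta)
  = tri (bits (rev gamma) ++ bits (rev alpha)) (bits nu) (bits delta ++ bits beta).
Proof.
move=> sza szb szg szd sznu.
rewrite Tri_puzzle ?puzzle_sum ?size_map ?size_cat; try lia.
by rewrite /bits -map_rev rev_cat !map_cat.
Qed.

Theorem theorem1 (a a0 a1 c c0 c1 : nat)
    (alpha beta gamma delta nu : seq bool)
    (ha : a = a0 + a1) (hc : c = c0 + c1)
    (halpha : alpha \in binstrings a a1) (hbeta : beta \in binstrings a a1)
    (hgamma : gamma \in binstrings c c1) (hdelta : delta \in binstrings c c1)
    (hnu : nu \in binstrings (a + c) (a1 + c1)) :
  [/\ Tri (a + c) (alpha ++ gamma) nu (delta ++ beta)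
        = Tri (a + c) (beta ++ gamma) nu (delta ++ alpha),
      Tri (a + c) (beta ++ gamma) nu (delta ++ alpha)
        = Tri (a + c) (alpha ++ delta) nu (gamma ++ beta)
    & Tri (a + c) (alpha ++ delta) nu (gamma ++ beta)
        = Tri (a + c) (beta ++ delta) nu (gamma ++ alpha)].
Proof.
have count_id s : count_mem true s = count id s by apply: eq_count => -[].
have binP n k s : s \in binstrings n k -> size s = n /\ count id s = k.
  by rewrite inE count_id => /andP[/eqP-> /eqP->].
have [sza ca] := binP _ _ _ halpha; have [szb cb] := binP _ _ _ hbeta.
have [szg cg] := binP _ _ _ hgamma; have [szd cd] := binP _ _ _ hdelta.
have [szn _] := binP _ _ _ hnu.
have swap_corner g d : size g = c -> size d = c ->
    Tri (a + c) (alpha ++ g) nu (d ++ beta) = Tri (a + c) (beta ++ g) nu (d ++ alpha).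
  move=> szg' szd'; rewrite !Tri_tri //.
  apply: tri_corner; rewrite ?size_map ?size_rev; try lia.
  by move=> sg szs; apply: (tri_corner_comm (a0 := a0) (a1 := a1)); lia.
have swap_ends :
    Tri (a + c) (alpha ++ gamma) nu (delta ++ beta) = Tri (a + c) (alpha ++ delta) nu
      (gamma ++ beta).
  rewrite !Tri_tri //; apply: (@tri_swap _ _ _ c0 c1) => //;
    rewrite ?bits_no10 ?size_map ?size_rev; try lia.
  (* The balance condition holds because [alpha] and [beta] have equally many zeros. *)
  have := count_bits (rev alpha); have := count_bits beta.
  by rewrite size_rev count_rev count_bitsC; lia.
by rewrite -(swap_corner gamma delta) // swap_ends; split=> //; apply: swap_corner.
Qed.
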